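(* Let $n=k+m$, $0\le k<n$, and let $L(\lambda)=L^{(0)}+\lambda^{-1}L^{(1)}$ with $L^{(0)}=\sum_{x\in[n]}e_{x,x}\otimes h_x$ and $L^{(1)}=\sum_{x,y\in[n]}e_{x,y}\otimes L^{(1)}_{x,y}$, where $h_x,L^{(1)}_{x,y}$ are the generators of $\mathfrak{gl}_{k,m}$ (with $h_x=1$ for $x\in[k]$). Let $t(\lambda)=L(\lambda)L^{-1}(-\lambda)$ and $\tau(\lambda)=\mathrm{tr}(d\,t(\lambda))$, where $d=\sum_{x\in[n]}\theta_xe_{x,x}$, $\theta_x=1$ if $x\in[k]$ and $\theta_x=-1$ if $x\in X_k^+$. Then $[\tau(\lambda),\mathfrak g]=0$ for all $\mathfrak g\in\mathfrak{gl}_{k,m}$.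
   Context: $[n]=\{1,\dots,n\}$, $X_k^+=\{k+1,\dots,n\}$, $e_{x,y}$ are the elementary $n\times n$ matrices, $[\mathrm a,\mathrm b]=\mathrm a\mathrm b-\mathrm b\mathrm a$, $\mathbf 1_{x\in X_k^+}$ is $1$ if $x\in X_k^+$ and $0$ otherwise. $\mathfrak{gl}_{k,m}$ ($k+m=n$) is the unital associative $\mathbb C$-algebra generated by invertible elements $h_z$, $z\in X_k^+$, and $L^{(1)}_{x,y}$, $x,y\in[n]$, with the relations (where $h_z:=1$ for $z\in[k]$) $$[h_x,h_y]=0\ (x,y\in X_k^+),\qquad [L^{(1)}_{x,y},h_z]=2L^{(1)}_{x,y}h_x\delta_{z,x}-2h_yL^{(1)}_{x,y}\delta_{y,z}\ (z\in X_k^+),$$ $$[L^{(1)}_{x,y},L^{(1)}_{z,w}]-2L^{(1)}_{x,y}L^{(1)}_{x,w}\,\delta_{x,z}\mathbf 1_{x\in X_k^+}+2L^{(1)}_{z,y}L^{(1)}_{x,y}\,\delta_{y,w}\mathbf 1_{y\in X_k^+}=L^{(1)}_{z,y}h_x\delta_{x,w}-h_yL^{(1)}_{x,w}\delta_{y,z}.$$ For $A=\sum_{x,y}e_{x,y}\otimes A_{x,y}$ the trace is $\mathrm{tr}(A)=\sum_xA_{x,x}$. Since $L^{(0)}$ is invertible, $L(\lambda)$ is invertible as a formal power series in $\lambda^{-1}$ with coefficients in $\mathrm{End}(\mathbb C^n)\otimes\mathfrak{gl}_{k,m}$; $L^{-1}(-\lambda)$ denotes the inverse of $L(-\lambda)$.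 Thus $\tau(\lambda)$ is a formal power series in $\lambda^{-1}$ with coefficients in $\mathfrak{gl}_{k,m}$, and the assertion is that every coefficient is central. *)

(* Defs.v *)
From HB Require Import structures.
From mathcomp Require Import all_boot all_order all_algebra.
From mathcomp Require Import ring_quotient.
From mathcomp Require Import boolp classical_sets.
From mathcomp Require Import monalg.

Set Implicit Arguments.
Unset Strict Implicit.
Unset Printing Implicit Defensive.

Import GRing.Theory.
Local Open Scope ring_scope.
Local Open Scope quotient_scope.

Definition brk (A : pzRingType) (a b : A) : A := a * b - b * a.

(* Quotient of a (possibly noncommutative) algebra by the two-sided ideal
   generated by the differences u - v with r u v.  MathComp only equips
   quotients of commutative rings with a product. *)
Section QuotientAlgebra.
Variables (F : comNzRingType) (A : algType F) (r : A -> A -> Prop).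

Inductive ideal_gen : A -> Prop :=
| ideal_rel u v : r u v -> ideal_gen (u - v)
| ideal_0 : ideal_gen 0
| ideal_add u v : ideal_gen u -> ideal_gen v -> ideal_gen (u + v)
| ideal_mull a u : ideal_gen u -> ideal_gen (a * u)
| ideal_mulr a u : ideal_gen u -> ideal_gen (u * a).

Definition ideal_pred : A -> bool := fun u => `[< ideal_gen u >].

Fact ideal_pred_zmod : zmod_closed ideal_pred.
Proof.
split=> [|u v /asboolP hu /asboolP hv]; apply/asboolP; first exact: ideal_0.
by apply: ideal_add => //; rewrite -mulN1r; apply: ideal_mull.
Qed.

HB.instance Definition _ := GRing.isZmodClosed.Build A ideal_pred
  ideal_pred_zmod.

Definition ideal := GRing.ZmodClosed.clone A ideal_pred _.
Definition quot_alg := {ideal_quot ideal}.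
HB.instance Definition _ := GRing.Zmodule.on quot_alg.
HB.instance Definition _ := EqQuotient.on quot_alg.

Definition quot_one : quot_alg := lift_cst quot_alg 1.
Definition quot_mul := lift_op2 quot_alg *%R.
Definition quot_scale (c : F) := lift_op1 quot_alg ( *:%R c).

Lemma quot_eqP u v : \pi_quot_alg u = \pi_quot_alg v <-> ideal_gen (u - v).
Proof.
split=> [/eqP|h]; first by rewrite piE /Quotient.equiv => /asboolP.
by apply/eqP; rewrite piE /Quotient.equiv; apply/asboolP.
Qed.

Lemma quot_repr u : ideal_gen (u - repr (\pi_quot_alg u)).
Proof. by apply/quot_eqP; rewrite reprK. Qed.

Canonical quot_pi_one := PiConst quot_one.

Fact quot_pi_mul : {morph \pi_quot_alg : u v / u * v >-> quot_mul u v}.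
Proof.
move=> u v; unlock quot_mul; apply/quot_eqP; set u' := repr _; set v' := repr _.
have -> : u * v - u' * v' = (u - u') * v + u' * (v - v').
  by rewrite mulrBl mulrBr addrA subrK.
by apply: ideal_add; [apply: ideal_mulr|apply: ideal_mull]; apply: quot_repr.
Qed.
Canonical quot_pi_mul_morph := PiMorph2 quot_pi_mul.

Fact quot_pi_scale c : {morph \pi_quot_alg : u / c *: u >-> quot_scale c u}.
Proof.
move=> u; unlock quot_scale; apply/quot_eqP.
rewrite -scalerBr -[_ - _]mul1r scalerAl.
exact/ideal_mull/quot_repr.
Qed.
Canonical quot_pi_scale_morph c := PiMorph1 (quot_pi_scale c).

Fact quot_mulA : associative quot_mul.
Proof. by move=> x y z; rewrite -[x]reprK -[y]reprK -[z]reprK !piE mulrA. Qed.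

Fact quot_mul1 : left_id quot_one quot_mul.
Proof. by move=> x; rewrite -[x]reprK !piE mul1r. Qed.

Fact quot_mulr1 : right_id quot_one quot_mul.
Proof. by move=> x; rewrite -[x]reprK !piE mulr1. Qed.

Fact quot_mulDl : left_distributive quot_mul +%R.
Proof. by move=> x y z; rewrite -[x]reprK -[y]reprK -[z]reprK !piE mulrDl. Qed.

Fact quot_mulDr : right_distributive quot_mul +%R.
Proof. by move=> x y z; rewrite -[x]reprK -[y]reprK -[z]reprK !piE mulrDr. Qed.

HB.instance Definition _ := GRing.Zmodule_isPzRing.Build quot_alg
  quot_mulA quot_mul1 quot_mulr1 quot_mulDl quot_mulDr.

Fact quot_scaleA c d x : quot_scale c (quot_scale d x) = quot_scale (c * d) x.
Proof. by rewrite -[x]reprK !piE scalerA. Qed.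

Fact quot_scale1 : left_id 1 quot_scale.
Proof. by move=> x; rewrite -[x]reprK !piE scale1r. Qed.

Fact quot_scaleDr : right_distributive quot_scale +%R.
Proof. by move=> c x y; rewrite -[x]reprK -[y]reprK !piE scalerDr. Qed.

Fact quot_scaleDl x : {morph quot_scale^~ x : c d / c + d}.
Proof. by move=> c d; rewrite -[x]reprK !piE scalerDl. Qed.

HB.instance Definition _ := GRing.Zmodule_isLmodule.Build F quot_alg
  quot_scaleA quot_scale1 quot_scaleDr quot_scaleDl.

Lemma quot_piD : {morph \pi_quot_alg : u v / u + v}.
Proof. by move=> u v; rewrite !piE. Qed.

Lemma quot_piM : {morph \pi_quot_alg : u v / u * v}.
Proof. exact: quot_pi_mul. Qed.

Lemma quot_pi1 : \pi_quot_alg 1 = 1.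
Proof. by rewrite piE. Qed.

Lemma quot_piZ c : {morph \pi_quot_alg : u / c *: u}.
Proof. exact: quot_pi_scale. Qed.

Lemma quot_scalerAl c (x y : quot_alg) : c *: (x * y) = (c *: x) * y.
Proof.
rewrite -[x]reprK -[y]reprK; move: (repr x) (repr y) => u v.
by rewrite -(quot_piM u v) -!quot_piZ -(quot_piM _ v) scalerAl.
Qed.

Lemma quot_scalerAr c (x y : quot_alg) : c *: (x * y) = x * (c *: y).
Proof.
rewrite -[x]reprK -[y]reprK; move: (repr x) (repr y) => u v.
by rewrite -(quot_piM u v) -!quot_piZ -(quot_piM u) scalerAr.
Qed.

End QuotientAlgebra.

Section FreeAlgebra.
Variables (F : comNzRingType) (K : monomType).

Fact malg_scalerAr c (x y : {malg F[K]}) : c *: (x * y) = x * (c *: y).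
Proof.
rewrite -(mul_malgC c y) mulrA -(mul_malgC c) mulrA; congr (_ * y).
rewrite !malgM_def fgmulUg fgmulgU; apply: eq_bigr => a _.
by rewrite mulrC mul1m mulm1.
Qed.

End FreeAlgebra.

(* The index x of the text is the ordinal of value x - 1, so X_k^+ is the set
   of ordinals x with k <= x. *)
Section GL.
Variables (F : comNzRingType) (k m : nat).

Definition Xplus := {x : 'I_(k + m) | (k <= x)%N}.

Definition gl_gen : Type := ((Xplus + Xplus) + 'I_(k + m) * 'I_(k + m))%type.
HB.instance Definition _ := Choice.on gl_gen.
Definition gen_h (z : Xplus) : gl_gen := inl (inl z).
Definition gen_hinv (z : Xplus) : gl_gen := inl (inr z).
Definition gen_L (x y : 'I_(k + m)) : gl_gen := inr (x, y).

Definition gl_free := {malg F[{fmonom gl_gen}]}.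
HB.instance Definition _ := GRing.Lalgebra.on gl_free.
HB.instance Definition _ := GRing.Lalgebra_isAlgebra.Build F gl_free
  (@malg_scalerAr F {fmonom gl_gen}).

Definition free_var (g : gl_gen) : gl_free := << fmu g >>.

Definition free_h (x : 'I_(k + m)) : gl_free :=
  if insub x is Some z then free_var (gen_h z) else 1.
Definition free_hinv (x : 'I_(k + m)) : gl_free :=
  if insub x is Some z then free_var (gen_hinv z) else 1.
Definition free_L (x y : 'I_(k + m)) : gl_free := free_var (gen_L x y).

Local Notation h := free_h.
Local Notation L := free_L.

Inductive gl_rel : gl_free -> gl_free -> Prop :=
| gl_rel_hV (x : 'I_(k + m)) : (k <= x)%N -> gl_rel (h x * free_hinv x) 1
| gl_rel_Vh (x : 'I_(k + m)) : (k <= x)%N -> gl_rel (free_hinv x * h x) 1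
| gl_rel_hh (x y : 'I_(k + m)) : (k <= x)%N -> (k <= y)%N ->
    gl_rel (brk (h x) (h y)) 0
| gl_rel_Lh (x y z : 'I_(k + m)) : (k <= z)%N ->
    gl_rel (brk (L x y) (h z))
           (2 * L x y * h x * (z == x)%:R - 2 * h y * L x y * (y == z)%:R)
| gl_rel_LL (x y z w : 'I_(k + m)) :
    gl_rel (brk (L x y) (L z w)
             - 2 * L x y * L x w * (x == z)%:R * (k <= x)%N%:R
             + 2 * L z y * L x y * (y == w)%:R * (k <= y)%N%:R)
           (L z y * h x * (x == w)%:R - h y * L x w * (y == z)%:R).

Definition gl := quot_alg gl_rel.
HB.instance Definition _ := GRing.PzRing.on gl.
HB.instance Definition _ := GRing.Lmodule.on gl.

Definition gl_pi : gl_free -> gl := \pi_(quot_alg gl_rel).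

Definition gl_h (x : 'I_(k + m)) : gl := gl_pi (free_h x).
Definition gl_hinv (x : 'I_(k + m)) : gl := gl_pi (free_hinv x).
Definition gl_L (x y : 'I_(k + m)) : gl := gl_pi (free_L x y).

(* 1 != 0 in gl, by the character h_z |-> 1, L_{x,y} |-> 0. *)
Definition is_genL (g : gl_gen) : bool := if g is inr _ then true else false.
Definition aug_monom (w : {fmonom gl_gen}) : F := (~~ has is_genL w)%:R.

Fact aug_monom_morph : mmorphism aug_monom.
Proof.
split=> [u v|]; rewrite /aug_monom ?fm1 // fmM has_cat negb_or.
by case: (has _ u); case: (has _ v); rewrite ?mul0r ?mul1r.
Qed.
HB.instance Definition _ :=
  monalg.isMultiplicative.Build {fmonom gl_gen} F aug_monom aug_monom_morph.

Definition aug : gl_free -> F := mmap idfun aug_monom.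
HB.instance Definition _ := GRing.RMorphism.on aug.

Let augB u v : aug (u - v) = aug u - aug v. Proof. exact: rmorphB. Qed.
Let augD u v : aug (u + v) = aug u + aug v. Proof. exact: rmorphD. Qed.
Let augM u v : aug (u * v) = aug u * aug v. Proof. exact: rmorphM. Qed.
Let aug1 : aug 1 = 1. Proof. exact: rmorph1. Qed.
Let aug0 : aug 0 = 0. Proof. exact: rmorph0. Qed.

Fact aug_gl_rel u v : gl_rel u v -> aug u = aug v.
Proof.
have aug_var g : aug (free_var g) = (~~ is_genL g)%:R.
  by rewrite /aug mmapU mul1r /aug_monom fmU /= orbF.
have augh x : aug (h x) = 1.
  by rewrite /h; case: insub => [z|]; rewrite ?aug_var ?aug1.
have augV x : aug (free_hinv x) = 1.
  by rewrite /free_hinv; case: insub => [z|]; rewrite ?aug_var ?aug1.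
have augL x y : aug (L x y) = 0 by rewrite /L aug_var mulr0n.
have zl u' v' : aug u' = 0 -> aug (u' * v') = 0.
  by move=> e; rewrite augM e mul0r.
have zr u' v' : aug v' = 0 -> aug (u' * v') = 0.
  by move=> e; rewrite augM e mulr0.
have zB u' v' : aug u' = 0 -> aug v' = 0 -> aug (u' - v') = 0.
  by move=> e f; rewrite augB e f subr0.
have zD u' v' : aug u' = 0 -> aug v' = 0 -> aug (u' + v') = 0.
  by move=> e f; rewrite augD e f addr0.
have zh u' v' : aug u' = 1 -> aug v' = 1 -> aug (u' * v' - v' * u') = aug 0.
  by move=> e f; rewrite augB !augM e f subrr aug0.
case=> [x _|x _|x y _ _|x y z _|x y z w]; rewrite /brk.
- by rewrite augM augh augV mulr1 aug1.
- by rewrite augM augh augV mulr1 aug1.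
- exact: zh.
- transitivity (0 : F).
    by apply: (zB); [apply: zl|apply: zr]; apply: augL.
  symmetry; apply: (zB); first exact/zl/zl/zr/augL.
  exact/zl/zr/augL.
- transitivity (0 : F).
    apply: (zD); last exact/zl/zl/zr/augL.
    apply: (zB); last exact/zl/zl/zr/augL.
    by apply: (zB); apply/zr/augL.
  symmetry; apply: (zB); first exact/zl/zl/augL.
  exact/zl/zr/augL.
Qed.

Fact gl_nonzero1 : (1 : gl) != 0.
Proof.
have augI u : ideal_gen gl_rel u -> aug u = 0.
  elim=> [a b /aug_gl_rel e||a b _ e _ f|a b _ e|a b _ e].
  - by rewrite augB e subrr.
  - exact: aug0.
  - by rewrite augD e f addr0.
  - by rewrite augM e mulr0.
  - by rewrite augM e mul0r.
apply/eqP=> e.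
have /quot_eqP/augI : gl_pi 1 = gl_pi 0 by rewrite /gl_pi quot_pi1 e !piE.
by rewrite subr0 aug1 => /eqP; rewrite oner_eq0.
Qed.
HB.instance Definition _ := GRing.PzSemiRing_isNonZero.Build gl gl_nonzero1.

HB.instance Definition _ :=
  GRing.Lmodule_isLalgebra.Build F gl (@quot_scalerAl _ _ gl_rel).
HB.instance Definition _ :=
  GRing.Lalgebra_isAlgebra.Build F gl (@quot_scalerAr _ _ gl_rel).

Lemma gl_rel_pi u v : gl_rel u v -> gl_pi u = gl_pi v.
Proof. by move=> uv; apply/quot_eqP/ideal_rel. Qed.

Lemma gl_hV x : gl_h x * gl_hinv x = 1.
Proof.
rewrite -quot_piM -quot_pi1; have [kx|kx] := boolP (k <= x)%N.
  exact/gl_rel_pi/gl_rel_hV.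
by rewrite /h /free_hinv insubN // mulr1.
Qed.

Lemma gl_Vh x : gl_hinv x * gl_h x = 1.
Proof.
rewrite -quot_piM -quot_pi1; have [kx|kx] := boolP (k <= x)%N.
  exact/gl_rel_pi/gl_rel_Vh.
by rewrite /h /free_hinv insubN // mulr1.
Qed.

End GL.

(* A series sum_j a_j lambda^(-j) is its sequence of coefficients. *)
Section Series.
Variable A : pzRingType.
Implicit Types a b : nat -> A.

Definition series_one : nat -> A := fun j => (j == 0%N)%:R.
Definition series_mul a b : nat -> A :=
  fun j => \sum_(i < j.+1) a i * b (j - i)%N.

Definition series_inverse a b : Prop :=
  series_mul a b = series_one /\ series_mul b a = series_one.
Definition series_inv a : nat -> A := xget (fun=> 0) (series_inverse a).

(* a(- lambda) *)
Definition series_oppvar a : nat -> A := fun j => (-1) ^+ j * a j.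

(* c0 + lambda^(-1) c1 *)
Definition series_linear (c0 c1 : A) : nat -> A :=
  fun j => match j with 0 => c0 | 1 => c1 | _ => 0 end.

Lemma series_oppvar_linear (c0 c1 : A) :
  series_oppvar (series_linear c0 c1) = series_linear c0 (- c1).
Proof.
apply: funext => -[|[|j]]; rewrite /series_oppvar /=.
- by rewrite expr0 mul1r.
- by rewrite expr1 mulN1r.
- by rewrite mulr0.
Qed.

Lemma series_linear_inv (c0 v c1 : A) : c0 * v = 1 -> v * c0 = 1 ->
  let b := series_linear c0 c1 in series_inverse b (series_inv b).
Proof.
move=> av va b; apply: xgetPex; exists (fun j => v * (- c1 * v) ^+ j).
split; apply: funext => -[|j].
- by rewrite /series_mul big_ord1 expr0 mulr1.
- rewrite /series_mul !big_ord_recl big1 /= => [|i _]; last by rewrite mul0r.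
  rewrite addr0 subn0 /bump /= subSS subn0 mulrA av mul1r.
  by rewrite exprS mulrA mulNr mulNr addNr.
- by rewrite /series_mul big_ord1 expr0 mulr1.
- rewrite /series_mul !big_ord_recr big1 /= => [|i _]; last first.
    have ltij := ltn_ord i; rewrite subSn ?(ltnW ltij) //.
    by move: ltij; rewrite -subn_gt0; case: (j - i)%N => // q _; rewrite mulr0.
  rewrite add0r subnn subSnn /= exprSr !mulrA -(mulrA _ v) va mulr1 mulrN.
  by rewrite subrr.
Qed.

End Series.

Section Transfer.
Variables (F : comNzRingType) (k m : nat).
Local Notation gl := (gl F k m).
Local Notation Mgl := 'M[gl]_(k + m).

(* The matrix with entries A x y stands for sum_{x,y} e_{x,y} (x) A x y. *)
Definition L0 : Mgl := diag_mx (\row_x gl_h F x).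
Definition L1 : Mgl := \matrix_(x, y) gl_L F x y.

Definition Lop : nat -> Mgl := series_linear L0 L1.

Definition theta (x : 'I_(k + m)) : gl := if (x < k)%N then 1 else -1.
Definition dmx : Mgl := diag_mx (\row_x theta x).

Definition tser : nat -> Mgl :=
  series_mul Lop (series_inv (series_oppvar Lop)).

Definition tau : nat -> gl := fun j => \tr (dmx *m tser j).

Definition L0inv : Mgl := diag_mx (\row_x gl_hinv F x).

Lemma L0V : L0 *m L0inv = 1%:M.
Proof.
rewrite mulmx_diag -diag_const_mx; congr diag_mx.
by apply/rowP=> x; rewrite !mxE gl_hV.
Qed.

Lemma L0Vl : L0inv *m L0 = 1%:M.
Proof.
rewrite mulmx_diag -diag_const_mx; congr diag_mx.
by apply/rowP=> x; rewrite !mxE gl_Vh.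
Qed.

(* L(- lambda) is invertible, so series_inv is not its default value here. *)
Lemma Lop_oppvar_inv : let b := series_oppvar Lop in
  series_inverse b (series_inv b).
Proof.
by rewrite /Lop series_oppvar_linear; apply: series_linear_inv L0V L0Vl.
Qed.

End Transfer.

(* Main.v *)
(* With s_{x,z} = -1 if x = z > k and s_{x,z} = 1 otherwise, the relations say
   that the entries of A = L1 L0^(-1) span a color Lie algebra of type gl whose
   commutation factor is c(xy, zw) = s_{xz} s_{xw} s_{yz} s_{yw}, and that h_z
   acts by the signs s_{xz} s_{yz}.  The commutation rule of A_{z,w} with the
   entries of a matrix is stable under matrix products, because the two
   contributions of the summation index cancel, and it implies that A_{z,w}
   commutes with the trace of that matrix against the signs s_{x,x}, which are
   the entries of d.  Finally t = (1 + A/lambda)(1 - A/lambda)^(-1), so that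
   tau_j = 2 tr (d A^j) for j > 0: these are Gelfand invariants. *)
From HB Require Import structures.
Require Import Defs.
From mathcomp Require Import all_boot all_order all_algebra.
From mathcomp Require Import complex reals.
From mathcomp Require Import ring_quotient monalg ring.

Set Implicit Arguments.
Unset Strict Implicit.
Unset Printing Implicit Defensive.

Local Open Scope ring_scope.
Import GRing.Theory.

(** * Commutation rules with signs, their stability under matrix products, and traces *)

Section ColorLie.
Variables (F : comNzRingType) (B : algType F) (n : nat).
Variable odd2 : 'I_n -> 'I_n -> bool.
Hypothesis odd2C : forall x y, odd2 x y = odd2 y x.

Definition sgn x y : F := (-1) ^+ odd2 x y.

Definition bichar x y z w : F := sgn x z * sgn x w * sgn y z * sgn y w.

Lemma sgnC x y : sgn x y = sgn y x.
Proof. by rewrite /sgn odd2C. Qed.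

Lemma sgnK x y : sgn x y * sgn x y = 1.
Proof. by rewrite /sgn -expr2 sqrr_sign. Qed.

(** The signs of the middle index [u] occur twice and square to 1, so the factor is multiplicative
    along matrix products. *)
Lemma bichar_trans x u y z w :
  bichar x u z w * bichar u y z w = bichar x y z w.
Proof.
rewrite /bichar.
transitivity (sgn x z * sgn x w * sgn y z * sgn y w
  * (sgn u z * sgn u z) * (sgn u w * sgn u w)); first by ring.
by rewrite !sgnK !mulr1.
Qed.

Lemma bichar_id x z w : bichar x x z w = 1.
Proof.
rewrite /bichar; transitivity ((sgn x z * sgn x z) * (sgn x w * sgn x w)).
  by ring.
by rewrite !sgnK mulr1.
Qed.

(* a plays the role of the generator A_{z,w}; the rule holds for every power C
   of A. *)
Definition adjoint_rule z w (a : B) (C : 'M[B]_n) : Prop := forall x y,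
  a * C x y = bichar x y z w *: (C x y * a)
    + (bichar x y z w * sgn y y * (y == z)%:R) *: C x w
    - (sgn x x * (x == w)%:R) *: C z y.

Lemma adjoint_rule_mul z w a C D :
  adjoint_rule z w a C -> adjoint_rule z w a D -> adjoint_rule z w a (C *m D).
Proof.
move=> hC hD x y; rewrite !mxE mulr_sumr.
(* Moving [a] past [C x u] and then past [D u y] leaves two extra terms, supported at [u = z] and
   [u = w]; both are multiples of the same product [C x w * D z y]. *)
have step u : a * (C x u * D u y) =
    bichar x y z w *: (C x u * D u y * a)
    + (bichar x y z w * sgn y y * (y == z)%:R) *: (C x u * D u w)
    - (sgn x x * (x == w)%:R) *: (C z u * D u y)
    + ((bichar x u z w * sgn u u * (u == z)%:R) *: (C x w * D z y)
       - (bichar x u z w * sgn u u * (u == w)%:R) *: (C x w * D z y)).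
  move: (hC x u) (hD u y) (bichar_trans x u y z w).
  move: (bichar x u z w) (bichar u y z w) (bichar x y z w) => c1 c2 c hu hy <-.
  rewrite mulrA hu !mulrDl mulNr -!scalerAl -(mulrA _ a) hy !mulrDr mulrN.
  rewrite -!scalerAr !scalerDr scalerN !scalerA !mulrA.
  have -> : (c1 * sgn u u * (u == w)%:R) *: (C x u * D z y) =
            (c1 * sgn u u * (u == w)%:R) *: (C x w * D z y).
    by case: eqP => [->|]; rewrite ?mulr0 ?scale0r.
  have -> : (c1 * sgn u u * (u == z)%:R) *: (C x w * D u y) =
            (c1 * sgn u u * (u == z)%:R) *: (C x w * D z y).
    by case: eqP => [->|]; rewrite ?mulr0 ?scale0r.
  rewrite -!addrA; congr (_ + (_ + _)).
  by rewrite addrCA [RHS]addrCA; congr (_ + _); rewrite addrC.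
rewrite (eq_bigr _ (fun u _ => step u)) !big_split /= !sumrN.
rewrite mulr_suml !scaler_sumr -[RHS]addr0; congr (_ + _).
have delta u0 : \sum_u bichar x u z w * sgn u u * (u == u0)%:R
    = bichar x u0 z w * sgn u0 u0.
  rewrite (bigD1 u0) //= eqxx mulr1 big1 ?addr0 // => u /negPf->.
  by rewrite mulr0.
(* The two extra terms cancel after summation: by symmetry of [sgn], both coefficients equal
   [sgn x z * sgn x w * sgn z w]. *)
rewrite -!scaler_suml !delta -scalerBl; suff -> : bichar x z z w * sgn z z
    = bichar x w z w * sgn w w by rewrite subrr scale0r.
rewrite /bichar (sgnC w z).
transitivity (sgn x z * sgn x w * sgn z w * (sgn z z * sgn z z)); first by ring.
by rewrite sgnK -(sgnK w w); ring.
Qed.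

(** On the diagonal the commutation factor is 1 and the weights [sgn x x] square to 1. What remains
    is [C z w] once from [x = z] and [- C z w] once from [x = w]. *)
Lemma adjoint_rule_trace z w a C : adjoint_rule z w a C ->
  GRing.comm a (\sum_x sgn x x *: C x x).
Proof.
move=> hC; rewrite /GRing.comm mulr_sumr mulr_suml.
have step x : a * (sgn x x *: C x x) = (sgn x x *: C x x) * a
    + (x == z)%:R *: C z w - (x == w)%:R *: C z w.
  rewrite -scalerAr hC bichar_id !mul1r scale1r !scalerDr scalerN !scalerA.
  rewrite scalerAl !mulrA sgnK !mul1r.
  congr (_ + _ - _); case: eqP => [->|_]; rewrite ?scale0r //.
rewrite (eq_bigr _ (fun x _ => step x)) sumrB big_split /= -!scaler_suml.
have sum1 u : \sum_(x < n) (x == u)%:R = 1 :> F.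
  by rewrite (bigD1 u) // eqxx big1 /= ?addr0 // => v /negPf->.
by rewrite !sum1 addrK.
Qed.

Definition weighted (z : 'I_n) (b : B) (C : 'M[B]_n) : Prop :=
  forall x y, b * C x y = (sgn x z * sgn y z) *: (C x y * b).

Lemma weighted_mul z b C D :
  weighted z b C -> weighted z b D -> weighted z b (C *m D).
Proof.
move=> hC hD x y; rewrite !mxE mulr_sumr mulr_suml scaler_sumr.
apply: eq_bigr => u _; rewrite mulrA hC -scalerAl -(mulrA _ b) hD.
rewrite -scalerAr scalerA -[C x u * D u y * b]mulrA; congr (_ *: _).
by rewrite -mulrA (mulrA (sgn u z)) sgnK mul1r.
Qed.

Lemma weighted_trace z b C : weighted z b C ->
  GRing.comm b (\sum_x sgn x x *: C x x).
Proof.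
move=> hC; rewrite /GRing.comm mulr_sumr mulr_suml; apply: eq_bigr => x _.
by rewrite -scalerAr hC sgnK scale1r scalerAl.
Qed.

(** Conjugation by [h] acts on entries by signs, which are their own inverses. *)
Lemma weighted_inv z h v C : h * v = 1 -> v * h = 1 ->
  weighted z h C -> weighted z v C.
Proof.
move=> hv vh hC x y.
have e : v * (h * C x y) * v = C x y * v by rewrite mulrA vh mul1r.
move: e; rewrite hC -scalerAr -scalerAl !mulrA.
rewrite -(mulrA _ h) hv mulr1 => <-.
by rewrite scalerA mulrACA !sgnK mulr1 scale1r.
Qed.

(** * From the sign form of the defining relations to the rules for [A] *)

Section Generators.
Variables (h v : 'I_n -> B) (E : 'M[B]_n).
Hypothesis hv : forall x, h x * v x = 1.
Hypothesis vh : forall x, v x * h x = 1.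
Hypothesis hh : forall x y, h x * h y = h y * h x.
Hypothesis Eh : forall x y z,
  sgn x z *: (E x y * h z) = sgn y z *: (h z * E x y).
Hypothesis EE : forall x y z w,
  sgn x z *: (E x y * E z w) - sgn y w *: (E z w * E x y)
  = (x == w)%:R *: (E z y * h x) - (y == z)%:R *: (h y * E x w).

Definition ratio : 'M[B]_n := \matrix_(x, y) (E x y * v y).
Local Notation A := ratio.

Lemma ratioE x y : E x y = A x y * h y.
Proof. by rewrite mxE -mulrA vh mulr1. Qed.

Lemma weighted_ratio z : weighted z (h z) A.
Proof.
move=> x y; rewrite mxE.
have hvC : v y * h z = h z * v y.
  by rewrite -[LHS]mulr1 -(hv y) mulrA -(mulrA (v y)) hh mulrA vh mul1r.
rewrite -mulrA hvC !mulrA.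
have -> : h z * E x y = (sgn x z * sgn y z) *: (E x y * h z).
  by rewrite mulrC -scalerA Eh scalerA sgnK scale1r.
by rewrite -scalerAl.
Qed.

Lemma adjoint_rule_ratio z w : adjoint_rule z w (A z w) A.
Proof.
move=> x y; have := EE x y z w.
rewrite !ratioE => e.
(* The right factor [v w * v y] cancels the [h]'s once they have been moved past entries of [A] at
   the cost of signs; the scalar [sgn x w] normalizes the coefficient of [A z w * A x y] to 1. *)
have {e} := congr1 (fun t => sgn x w *: (t * (v w * v y))) e.
have vhC : h y * h w * (v w * v y) = 1.
  by rewrite mulrA -(mulrA (h y)) hv mulr1 hv.
have t1 : A x y * h y * (A z w * h w) * (v w * v y) =
    (sgn z y * sgn w y) *: (A x y * A z w).
  rewrite (mulrA (A x y * h y)) -(mulrA (A x y)) (weighted_ratio y z w).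
  by rewrite -scalerAr -!scalerAl mulrA -!mulrA (mulrA (h y)) vhC mulr1.
have t2 : A z w * h w * (A x y * h y) * (v w * v y) =
    (sgn x w * sgn y w) *: (A z w * A x y).
  rewrite (mulrA (A z w * h w)) -(mulrA (A z w)) (weighted_ratio w x y).
  rewrite -scalerAr -!scalerAl mulrA -!mulrA (mulrA (h w)) (hh w y) vhC.
  by rewrite mulr1.
have t3 : (x == w)%:R *: (A z y * h y * h x * (v w * v y)) =
    (x == w)%:R *: A z y.
  case: eqP => [->|]; rewrite ?scale0r //.
  by rewrite -!mulrA (mulrA (h y)) vhC mulr1.
have t4 : h y * (A x w * h w) * (v w * v y) =
    (sgn x y * sgn w y) *: A x w.
  rewrite (mulrA (h y) (A x w)) (weighted_ratio y x w) -!scalerAl -!mulrA.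
  by rewrite (mulrA (h y)) vhC mulr1.
rewrite !mulrBl -!scalerAl t1 t2 t3 t4 !scalerBr !scalerA.
have -> : sgn x w * sgn x z * (sgn z y * sgn w y) = bichar x y z w.
  by rewrite /bichar (sgnC z) (sgnC w y); ring.
have -> : sgn x w * sgn y w * (sgn x w * sgn y w) = 1.
  by rewrite mulrACA !sgnK mulr1.
have -> : sgn x w * (x == w)%:R = sgn x x * (x == w)%:R.
  by case: eqP => [->|]; rewrite ?mulr0.
have -> : sgn x w * (y == z)%:R * (sgn x y * sgn w y) =
    bichar x y z w * sgn y y * (y == z)%:R.
  case: eqP => [<-|_]; last by rewrite mulr0 mul0r mulr0.
  rewrite !mulr1 /bichar (sgnC w) -(mulr1 (_ * _)) -(sgnK y y).
  by ring.
rewrite scale1r => e; rewrite -[LHS](subKr (bichar x y z w *: (A x y * A z w))).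
by rewrite e opprB addrA.
Qed.

End Generators.
End ColorLie.

(* Stated over abstract rings because rewriting by rmorphM in gl_free unfolds
   the generators down to the monoid algebra. *)
Section MorphismRules.
Variables (A B : nzRingType) (f : {rmorphism A -> B}).

Lemma rmorph_brk u v : f (brk u v) = brk (f u) (f v).
Proof. by rewrite rmorphB !rmorphM. Qed.

Lemma rmorph_sub_nat u v a b (i j : bool) :
  f (2 * u * a * i%:R - 2 * b * v * j%:R)
  = 2 * f u * f a * i%:R - 2 * f b * f v * j%:R.
Proof. by rewrite rmorphB !rmorphM !rmorph_nat. Qed.

Lemma rmorph_brk_sub_add u v c d p q (i1 i2 j1 j2 : bool) :
  f (brk u v - 2 * c * d * i1%:R * i2%:R + 2 * p * q * j1%:R * j2%:R)
  = brk (f u) (f v) - 2 * f c * f d * i1%:R * i2%:R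
    + 2 * f p * f q * j1%:R * j2%:R.
Proof. by rewrite rmorphD rmorphB rmorph_brk !rmorphM !rmorph_nat. Qed.

Lemma rmorph_sub_indicator u v c d (i j : bool) :
  f (u * v * i%:R - c * d * j%:R) = f u * f v * i%:R - f c * f d * j%:R.
Proof. by rewrite rmorphB !rmorphM !rmorph_nat. Qed.

End MorphismRules.

(** * The relations of the algebra in sign form, and centrality tested on generators *)

Section Presentation.
Variables (F : comNzRingType) (k m : nat).
Local Notation pi := (@gl_pi F k m).
Local Notation h := (@gl_h F k m).
Local Notation v := (@gl_hinv F k m).
Local Notation E := (@gl_L F k m).

Fact gl_pi_zmod_morphism : zmod_morphism pi.
Proof. by move=> u w; rewrite /gl_pi !piE. Qed.

Fact gl_pi_monoid_morphism : monoid_morphism pi.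
Proof. by split; [exact: quot_pi1 | exact: quot_piM]. Qed.

HB.instance Definition _ :=
  GRing.isZmodMorphism.Build (gl_free F k m) (gl F k m) pi gl_pi_zmod_morphism.
HB.instance Definition _ :=
  GRing.isMonoidMorphism.Build (gl_free F k m) (gl F k m) pi
    gl_pi_monoid_morphism.

Lemma gl_h_small (x : 'I_(k + m)) : ~~ (k <= x)%N -> h x = 1.
Proof. by move=> kx; rewrite /gl_h /free_h insubN // rmorph1. Qed.

Lemma gl_hC x y : h x * h y = h y * h x.
Proof.
have [kx|/gl_h_small->] := boolP (k <= x)%N; last by rewrite mul1r mulr1.
have [ky|/gl_h_small->] := boolP (k <= y)%N; last by rewrite mul1r mulr1.
have := gl_rel_pi (@gl_rel_hh F k m x y kx ky).
by rewrite (rmorph_brk pi) (rmorph0 pi) => /subr0_eq.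
Qed.

Definition odd2 (x y : 'I_(k + m)) : bool := (x == y) && (k <= x)%N.

Lemma odd2C x y : odd2 x y = odd2 y x.
Proof. by rewrite /odd2 eq_sym; case: eqP => // ->. Qed.

Local Notation osgn := (@sgn F (k + m) odd2).

(** Since [- g = g - 2 * g], the correction terms with coefficient 2 in the presentation amount to
    signs on the two products of a commutator. *)
Lemma sgn_scale x z (g : gl F k m) :
  osgn x z *: g = g - 2 * g * (x == z)%:R * (k <= x)%N%:R.
Proof.
rewrite /sgn /odd2; case: eqP => _; case: (k <= x)%N.
- by rewrite expr1 scaleN1r !mulr1 mulr_natl mulr2n opprD addNKr.
all: by rewrite expr0 scale1r ?mulr0 ?mul0r subr0.
Qed.

Lemma gl_Lh x y z : osgn x z *: (E x y * h z) = osgn y z *: (h z * E x y).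
Proof.
have [kz|kz] := boolP (k <= z)%N; last first.
  rewrite gl_h_small // mulr1 mul1r /sgn /odd2.
  by case: eqP => [->|_]; case: eqP => [->|_]; rewrite ?(negPf kz).
have e : brk (E x y) (h z)
    = 2 * E x y * h x * (z == x)%:R - 2 * h y * E x y * (y == z)%:R.
  exact: etrans (esym (rmorph_brk pi _ _)) (etrans
    (gl_rel_pi (@gl_rel_Lh F k m x y z kz)) (rmorph_sub_nat pi _ _ _ _ _ _)).
rewrite !sgn_scale.
have dk u : (u == z)%:R * (k <= u)%:R = (u == z)%:R :> gl F k m.
  by case: eqP => [->|_]; rewrite ?kz ?mulr1 ?mul0r.
rewrite -!(mulrA _ (_ == z)%:R) !dk (eq_sym x) !mulrA; apply/eqP.
rewrite -subr_eq0 opprB [_ * _ - h z * _]addrC addrACA -/(brk _ _) e.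
(* Under the Kronecker deltas [h x] and [h y] become [h z], which matches the terms produced by the
   signs. *)
have -> : 2 * E x y * h x * (z == x)%:R = 2 * E x y * h z * (z == x)%:R.
  by case: eqP => [->|_]; rewrite ?mulr0.
have -> : 2 * h y * E x y * (y == z)%:R = 2 * h z * E x y * (y == z)%:R.
  by case: eqP => [->|_]; rewrite ?mulr0.
by rewrite addrACA subrr addNr addr0.
Qed.

Lemma gl_LL x y z w :
  osgn x z *: (E x y * E z w) - osgn y w *: (E z w * E x y)
  = (x == w)%:R *: (E z y * h x) - (y == z)%:R *: (h y * E x w).
Proof.
have : brk (E x y) (E z w)
      - 2 * E x y * E x w * (x == z)%:R * (k <= x)%N%:R
      + 2 * E z y * E x y * (y == w)%:R * (k <= y)%N%:R
    = E z y * h x * (x == w)%:R - h y * E x w * (y == z)%:R.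
  exact: etrans (esym (rmorph_brk_sub_add pi _ _ _ _ _ _ _ _ _ _)) (etrans
    (gl_rel_pi (@gl_rel_LL F k m x y z w))
    (rmorph_sub_indicator pi _ _ _ _ _ _)).
rewrite !sgn_scale !mulrA !scaler_nat !mulr_natr => <-.
rewrite opprB [_ - E z w * _]addrC addrACA addrA.
(* Where the deltas are nonzero, the quadratic corrections are multiples of [E x y * E z w] and
   [E z w * E x y]. *)
by congr (_ - _ + _); case: eqP => [->|].
Qed.

(** Every element is the image of a linear combination of words, and commuting with [a] passes to
    products and linear combinations. *)
Lemma gl_comm_generators (a : gl F k m) :
  (forall x, GRing.comm a (h x)) -> (forall x, GRing.comm a (v x)) ->
  (forall x y, GRing.comm a (E x y)) -> forall g, GRing.comm a g.
Proof.
move=> ah av aE g; rewrite -[g]reprK; move: (repr g) => u.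
have aM w : GRing.comm a (pi << w >>).
  case: w => s; elim: s => [|i s IH].
    suff -> : << FMonom [::] >> = 1 :> gl_free F k m.
      by rewrite rmorph1; exact: commr1.
    by rewrite -fmoneE.
  have -> : << FMonom (i :: s) >> = free_var F i * << FMonom s >>.
    rewrite malgM_def fgmulUU mulr1; congr (<< 1 *g _ >>).
    by apply/eqP; rewrite fmP fmM fmU.
  rewrite rmorphM; apply: commrM IH.
  case: i => [[z|z]|[x y]].
  - suff -> : free_var F (inl (inl z)) = free_h F (val z) by exact: ah.
    by rewrite /free_h valK.
  - suff -> : free_var F (inl (inr z)) = free_hinv F (val z) by exact: av.
    by rewrite /free_hinv valK.
  - exact: aE.
rewrite [u]monalgE (raddf_sum pi); apply: commr_sum => w _.
have -> : << u@_w *g w >> = u@_w *: << w >> :> gl_free F k m.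
  by apply/malgP => i; rewrite mcoeffZ !mcoeffU mulr_natr.
suff: GRing.comm a (u@_w *: pi << w >>) by rewrite -quot_piZ.
by rewrite /GRing.comm -scalerAr -scalerAl aM.
Qed.

End Presentation.

(** * Coefficients of a product with a linear series *)

Section SeriesLinear.
Variable A : pzRingType.

Lemma series_mul_linear0 (c0 c1 : A) b :
  series_mul (series_linear c0 c1) b 0 = c0 * b 0%N.
Proof. by rewrite /series_mul big_ord1. Qed.

Lemma series_mul_linearS (c0 c1 : A) b j :
  series_mul (series_linear c0 c1) b j.+1 = c0 * b j.+1 + c1 * b j.
Proof.
rewrite /series_mul !big_ord_recl big1 /= => [|i _]; last by rewrite mul0r.
by rewrite addr0 subn0 /bump /= subSS subn0.
Qed.

End SeriesLinear.

(** * Coefficients of the transfer matrix as powers of [A], and their centrality *)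

Section TransferMatrix.
Variables (F : comNzRingType) (k m : nat).
Local Notation h := (@gl_h F k m).
Local Notation v := (@gl_hinv F k m).
Local Notation L0 := (L0 F k m).
Local Notation L1 := (L1 F k m).
Local Notation L0inv := (L0inv F k m).
Local Notation osgn := (@sgn F (k + m) (@odd2 k m)).
Local Notation A := (ratio v L1).

Let b := series_inv (series_oppvar (Lop F k m)).

Lemma Lop_oppvar_rec : L0 *m b 0 = 1%:M /\
  forall j, L0 *m b j.+1 = L1 *m b j.
Proof.
have [e _] := Lop_oppvar_inv F k m.
move: e; rewrite -/b /Lop series_oppvar_linear => e; split=> [|j].
  by have := congr1 (fun f => f 0%N) e; rewrite series_mul_linear0.
have := congr1 (fun f => f j.+1) e; rewrite series_mul_linearS mulNr.
by move/subr0_eq.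
Qed.

Lemma ratio_mulmx : A = L1 *m L0inv.
Proof. by apply/matrixP => x y; rewrite mul_mx_diag !mxE. Qed.

(** This is the power of [A] with exponent [j + 1]: the recursion gives [b j] as [L0inv] times the
    [j]-th power of [A]. *)
Definition Lcoef j := L1 *m b j.

Lemma Lcoef0 : Lcoef 0 = A.
Proof.
have [e _] := Lop_oppvar_rec.
by rewrite /Lcoef -[b 0]mul1mx -(L0Vl F k m) -mulmxA e mulmx1 ratio_mulmx.
Qed.

Lemma LcoefS j : Lcoef j.+1 = A *m Lcoef j.
Proof.
have [_ e] := Lop_oppvar_rec.
rewrite /Lcoef -[b j.+1]mul1mx -(L0Vl F k m) -mulmxA e ratio_mulmx.
by rewrite !mulmxA.
Qed.

Lemma tser0 : tser F k m 0 = 1%:M.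
Proof. by rewrite /tser series_mul_linear0; case: Lop_oppvar_rec. Qed.

(** The two contributions [L0 *m b j.+1] and [L1 *m b j] cancel in [L(-lambda) b = 1], hence are
    equal, and in [L(lambda) b] they add up. *)
Lemma tserS j : tser F k m j.+1 = Lcoef j + Lcoef j.
Proof.
rewrite /tser series_mul_linearS; congr (_ + _).
by case: Lop_oppvar_rec => _; apply.
Qed.

Lemma weighted_Lcoef z j : weighted (@odd2 k m) z (h z) (Lcoef j).
Proof.
have wA : weighted (@odd2 k m) z (h z) A.
  apply: weighted_ratio; [exact: gl_hV|exact: gl_Vh|exact: gl_hC|].
  by move=> x y u; rewrite !mxE; apply: gl_Lh.
by elim: j => [|j IH]; rewrite ?Lcoef0 // LcoefS; apply: weighted_mul.
Qed.

Lemma adjoint_rule_Lcoef z w j :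
  adjoint_rule (@odd2 k m) z w (A z w) (Lcoef j).
Proof.
have rA : adjoint_rule (@odd2 k m) z w (A z w) A.
  apply: (@adjoint_rule_ratio _ _ _ _ _ h).
  - by move=> x y; exact: odd2C.
  - exact: gl_hV.
  - exact: gl_Vh.
  - exact: gl_hC.
  - by move=> x y u; rewrite !mxE; apply: gl_Lh.
  - by move=> x y u t; rewrite !mxE; apply: gl_LL.
elim: j => [|j IH]; rewrite ?Lcoef0 // LcoefS.
by apply: adjoint_rule_mul => //; exact: odd2C.
Qed.

Lemma theta_scale x (g : gl F k m) : theta F x * g = osgn x x *: g.
Proof.
rewrite /theta /sgn /odd2 eqxx ltnNge; case: leqP => _ /=.
  by rewrite expr1 mulN1r scaleN1r.
by rewrite expr0 mul1r scale1r.
Qed.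

(** The constant term is the trace of [d], a sum of copies of 1 and -1. *)
Lemma tau0_comm (g : gl F k m) : GRing.comm g (tau F k m 0).
Proof.
rewrite /tau tser0 mulmx1 /mxtrace; apply: commr_sum => x _.
rewrite !mxE eqxx mulr1n /theta.
by case: ifP => _; [exact: commr1|apply/commrN/commr1].
Qed.

Lemma tauS j : tau F k m j.+1 =
  (\sum_x osgn x x *: Lcoef j x x) + (\sum_x osgn x x *: Lcoef j x x).
Proof.
rewrite /tau tserS mulmxDr mxtraceD /mxtrace.
by congr (_ + _); apply: eq_bigr => x _;
  rewrite mul_diag_mx !mxE theta_scale.
Qed.

Lemma tauS_comm j (g : gl F k m) : GRing.comm g (tau F k m j.+1).
Proof.
rewrite tauS; set t := \sum_x _.
suff tg : GRing.comm t g by apply: commrD; exact: commr_sym.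
have th x : GRing.comm t (h x).
  apply: commr_sym; apply: (@weighted_trace _ _ _ _ x).
  exact: weighted_Lcoef.
have tv x : GRing.comm t (v x).
  apply: commr_sym; apply: (@weighted_trace _ _ _ _ x).
  apply: weighted_inv (weighted_Lcoef x j); [exact: gl_hV|exact: gl_Vh].
apply: gl_comm_generators => // x y.
(* The trace rule speaks of [A x y], so the generator is factored through it and [h y]. *)
have -> : gl_L F x y = A x y * h y by rewrite !mxE -mulrA gl_Vh mulr1.
apply: commrM => //; apply: commr_sym.
by apply: (@adjoint_rule_trace _ _ _ _ x y); exact: adjoint_rule_Lcoef.
Qed.

End TransferMatrix.

Theorem proposition2p12 (R : realType) (k m : nat) (hkm : (k < k + m)%N)
    (j : nat) (g : gl R[i] k m) :
  brk (tau R[i] k m j) g = 0.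
Proof.
apply/eqP; rewrite subr_eq0; apply/eqP; apply: commr_sym.
by case: j => [|j]; [exact: tau0_comm|exact: tauS_comm].
Qed.
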